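(* Let $R$ be a commutative ring of prime characteristic $p$, let $\mathcal{I}(R)$ be the complete lattice of ideals of $R$, and for $I\in\mathcal{I}(R)$ let $I^*=\bigcap\{J\in\mathcal{I}(R):\ J\supset I\text{ and }J\text{ is tightly closed}\}$. The operation $*$ is the unique semiprime operation on $R$ such that, for $I\in\mathcal{I}(R)$, $I^*=I$ if and only if $I$ is tightly closed. Moreover, for all $I\in\mathcal{I}(R)$ one has $I^T\subset(I^* )^T=I^*$, with equalities holding if $R$ is Noetherian. In particular, $I^*$ for any $I\in\mathcal{I}(R)$ is the smallest tightly closed ideal of $R$ containing $I$, and $*$ equals the ordinary tight closure operation if $R$ is Noetherian.
   Context: Rings are unital. $R^o$ is the complement of the union of the minimal primes of $R$. For $I\in\mathcal{I}(R)$ and $q=p^e$, $I^{[q]}$ is the ideal of $R$ generated by $\{x^q:x\in I\}$. Define $I^T=\{x\in R:\ \exists c\in R^o\text{ such that }cx^q\in I^{[q]}\text{ for all sufficiently large }q=p^e\}$; for Noetherian $R$, the ordinary tight closure operation is $I\mapsto I^T$. An ideal $I$ is called tightly closed if $I^T=I$. A semiprime operation on $R$ is a nucleus on $\mathcal{I}(R)$ (ordered by inclusion, with ideal multiplication), i.e. an expansive, order-preserving, idempotent self-map $\star$ of $\mathcal{I}(R)$ with $I^\star J^\star\subset(IJ)^\star$ for all $I,J\in\mathcal{I}(R)$. *)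

(* Defs.v *)
From mathcomp Require Import all_boot all_algebra.
From mathcomp Require Import boolp classical_sets.

Set Implicit Arguments.
Unset Strict Implicit.
Unset Printing Implicit Defensive.

Import GRing.Theory.
Local Open Scope classical_set_scope.
Local Open Scope ring_scope.

(* The ideals of MathComp's ring_quotient are boolean predicates and are
   required to be proper; here ideals are arbitrary subsets, and the unit ideal
   is allowed. *)
Definition is_ideal (R : comNzRingType) (I : set R) : Prop :=
  [/\ I 0,
      forall x y, I x -> I y -> I (x + y) &
      forall a x, I x -> I (a * x)].

Record ideal (R : comNzRingType) := Ideal {
  ideal_set :> set R;
  ideal_setP : is_ideal ideal_set
}.

Lemma ideal_inj (R : comNzRingType) : injective (@ideal_set R).
Proof.
move=> [A HA] [B HB] /= E; subst B.
by rewrite (Prop_irrelevance HA HB).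
Qed.

Lemma bigcap_is_ideal (R : comNzRingType) (T : Type) (D : set T)
    (F : T -> set R) :
  (forall t, D t -> is_ideal (F t)) -> is_ideal (\bigcap_(t in D) F t).
Proof.
move=> H; split.
- by move=> t Dt; have [] := H t Dt.
- move=> x y Ix Iy t Dt; have [_ HD _] := H t Dt.
  by apply: HD; [exact: Ix | exact: Iy].
- by move=> a x Ix t Dt; have [_ _ HM] := H t Dt; apply: HM; exact: Ix.
Qed.

Definition ideal_bigcap (R : comNzRingType) (F : set (ideal R)) : ideal R :=
  @Ideal R (\bigcap_(J in F) J)
    (bigcap_is_ideal (fun J _ => ideal_setP J)).

Lemma smallest_is_ideal (R : comNzRingType) (G : set R) :
  is_ideal (smallest (@is_ideal R) G).
Proof. by apply: bigcap_is_ideal => A []. Qed.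

Definition ideal_span (R : comNzRingType) (G : set R) : ideal R :=
  Ideal (smallest_is_ideal G).

Definition ideal_mul (R : comNzRingType) (I J : ideal R) : ideal R :=
  ideal_span [set z | exists x y, [/\ ideal_set I x, ideal_set J y & z = x * y]].

Definition noetherian (R : comNzRingType) : Prop :=
  forall I : ideal R, exists s : seq R, I = ideal_span [set` s].

Definition prime_ideal (R : comNzRingType) (P : ideal R) : Prop :=
  ~ ideal_set P 1 /\
  forall a b, ideal_set P (a * b) -> ideal_set P a \/ ideal_set P b.

Definition minimal_prime (R : comNzRingType) (P : ideal R) : Prop :=
  prime_ideal P /\
  forall Q : ideal R, prime_ideal Q -> Q `<=` P -> Q = P.

(* R^o *)
Definition ring_o (R : comNzRingType) : set R :=
  ~` \bigcup_(P in @minimal_prime R) ideal_set P.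

(* I^[q] *)
Definition frob_power (R : comNzRingType) (I : ideal R) (q : nat) : ideal R :=
  ideal_span [set x ^+ q | x in ideal_set I].

(* I^T, as a subset of R; p is the characteristic *)
Definition tclosure (R : comNzRingType) (p : nat) (I : ideal R) : set R :=
  [set x | exists2 c, ring_o c &
     exists e0 : nat, forall e : nat, (e0 <= e)%N ->
       ideal_set (frob_power I (p ^ e)) (c * x ^+ (p ^ e))].

Definition tightly_closed (R : comNzRingType) (p : nat) (I : ideal R) : Prop :=
  tclosure p I = I.

(* I^* *)
Definition tstar (R : comNzRingType) (p : nat) (I : ideal R) : ideal R :=
  ideal_bigcap [set J : ideal R | I `<=` J /\ tightly_closed p J].

Record semiprime_operation (R : comNzRingType) (op : ideal R -> ideal R)
    : Prop := SemiprimeOperation {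
  semiprime_expansive : forall I : ideal R, I `<=` op I;
  semiprime_monotone : forall I J : ideal R, I `<=` J -> op I `<=` op J;
  semiprime_idempotent : forall I : ideal R, op (op I) = op I;
  semiprime_mul : forall I J : ideal R,
    ideal_mul (op I) (op J) `<=` op (ideal_mul I J)
}.

(* Main.v *)
(* Everything rests on two closure properties of the tightly closed ideals: they
   are stable under intersection, since I^T is monotone in I, and under residuals
   K : x, since x^q (K : x)^[q] is contained in K^[q]. The first makes * a closure
   operation whose fixed points are the tightly closed ideals, which determines
   it; the second gives I^* J^* in (IJ)^*, on applying minimality of I^* and then
   of J^*. When R is Noetherian, finitely many multipliers for generators of I^T
   combine into one c with c (I^T)^[q] in I^[q] for all large q, so I^T is already
   tightly closed. *)
Require Import Defs.
From mathcomp Require Import all_boot all_algebra.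
From mathcomp Require Import boolp classical_sets.

Set Implicit Arguments.
Unset Strict Implicit.
Unset Printing Implicit Defensive.

Import GRing.Theory.
Local Open Scope classical_set_scope.
Local Open Scope ring_scope.

Section Ideals.
Variable R : comNzRingType.
Implicit Types (I J K : ideal R) (G : set R) (c x y : R).

Lemma ideal_ext I J : I `<=` J -> J `<=` I -> I = J.
Proof. by move=> IJ JI; apply: ideal_inj; apply/seteqP. Qed.

Lemma ideal0 I : ideal_set I 0.
Proof. by have [] := ideal_setP I. Qed.

Lemma idealD I x y : ideal_set I x -> ideal_set I y -> ideal_set I (x + y).
Proof. by have [_ + _] := ideal_setP I; apply. Qed.

Lemma idealMl I c x : ideal_set I x -> ideal_set I (c * x).
Proof. by have [_ _] := ideal_setP I; apply. Qed.

Lemma ideal_span_sub G : G `<=` ideal_span G.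
Proof. exact: sub_smallest. Qed.

Lemma ideal_span_min G J : G `<=` J -> ideal_span G `<=` J.
Proof. by move=> GJ; apply: smallest_sub => //; exact: ideal_setP. Qed.

Lemma ideal_mulP I J K :
  ideal_mul I J `<=` K <->
  forall x y, ideal_set I x -> ideal_set J y -> ideal_set K (x * y).
Proof.
split=> [IJK x y Ix Jy|IJK]; first by apply: IJK; apply: ideal_span_sub; exists x, y.
by apply: ideal_span_min => _ [x [y [Ix Jy ->]]]; exact: IJK.
Qed.

Lemma residual_is_ideal K x : is_ideal [set y | ideal_set K (x * y)].
Proof.
split=> [|y z Ky Kz|a y Ky] /=; first by rewrite mulr0; exact: ideal0.
- by rewrite mulrDr; exact: idealD.
- by rewrite mulrCA; exact: idealMl.
Qed.

Definition residual K x : ideal R := Ideal (residual_is_ideal K x).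

Lemma ring_o1 : ring_o (1 : R).
Proof. by move=> [P [[P1 _] _] /P1]. Qed.

(** Minimal primes are prime. This is what lets several multipliers be merged into their product. *)
Lemma ring_oM c d : ring_o c -> ring_o d -> ring_o (c * d : R).
Proof.
move=> oc od [P mP]; have [[_ Pprime] _] := mP.
by case/Pprime => ?; [apply: oc | apply: od]; exists P.
Qed.

Lemma frob_power_mem I q x : ideal_set I x -> ideal_set (frob_power I q) (x ^+ q).
Proof. by move=> Ix; apply: ideal_span_sub; exists x. Qed.

Lemma frob_power_min I q J :
  (forall x, ideal_set I x -> ideal_set J (x ^+ q)) -> frob_power I q `<=` J.
Proof. by move=> IJ; apply: ideal_span_min => _ [x Ix <-]; exact: IJ. Qed.

Lemma frob_power_mono I J q : I `<=` J -> frob_power I q `<=` frob_power J q.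
Proof. by move=> IJ; apply: frob_power_min => x /IJ; exact: frob_power_mem. Qed.

End Ideals.

Section TightClosure.
Variables (R : comNzRingType) (p : nat).
Implicit Types (I J K : ideal R) (c x y : R).

Lemma sub_tclosure I : I `<=` tclosure p I.
Proof.
move=> x Ix; exists 1; first exact: ring_o1.
by exists 0%N => e _; rewrite mul1r; exact: frob_power_mem.
Qed.

Lemma tclosure_mono I J : I `<=` J -> tclosure p I `<=` tclosure p J.
Proof.
move=> IJ x [c oc [e0 xc]]; exists c => //; exists e0 => e /xc.
exact: frob_power_mono.
Qed.

Lemma tightly_closedP I : tightly_closed p I <-> tclosure p I `<=` I.
Proof.
split=> [->//|TI]; apply/seteqP; split=> //; exact: sub_tclosure.
Qed.

Lemma tightly_closed_residual K x :
  tightly_closed p K -> tightly_closed p (residual K x).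
Proof.
move=> /tightly_closedP TK; apply/tightly_closedP => y [c oc [e0 yc]].
apply: TK; exists c => //; exists e0 => e /yc.
(* Rewriting [c * (x * y) ^+ q] as [x ^+ q * (c * y ^+ q)] shows that the multiplier [c] of [y] also
   serves [x * y]; the inclusion below is then checked on generators, since
   [x ^+ q * z ^+ q = (x * z) ^+ q]. *)
rewrite exprMn mulrCA; set q := (p ^ e)%N.
suff: frob_power (residual K x) q `<=` residual (frob_power K q) (x ^+ q) by apply.
apply: frob_power_min => z Kxz /=; rewrite -exprMn; exact: frob_power_mem.
Qed.

Lemma sub_tstar I : I `<=` tstar p I.
Proof. by move=> x Ix J [+ _]; apply. Qed.

Lemma tstar_min I J : I `<=` J -> tightly_closed p J -> tstar p I `<=` J.
Proof. by move=> IJ tJ x; apply. Qed.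

Lemma tightly_closed_tstar I : tightly_closed p (tstar p I).
Proof.
apply/tightly_closedP => x Tx J [IJ tJ].
rewrite -[ideal_set J]tJ; apply: tclosure_mono Tx; exact: tstar_min.
Qed.

Lemma tclosure_sub_tstar I : tclosure p I `<=` tstar p I.
Proof.
rewrite -[ideal_set (tstar p I)]tightly_closed_tstar.
exact/tclosure_mono/sub_tstar.
Qed.

Lemma tstar_fixed I : tstar p I = I <-> tightly_closed p I.
Proof.
split=> [<-|tI]; first exact: tightly_closed_tstar.
by apply: ideal_ext; [apply: tstar_min | exact: sub_tstar].
Qed.

Lemma tstar_mul I J :
  ideal_mul (tstar p I) (tstar p J) `<=` tstar p (ideal_mul I J).
Proof.
set K := tstar p (ideal_mul I J); have tK : tightly_closed p K by exact: tightly_closed_tstar.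
have IJK : ideal_mul I J `<=` K by exact: sub_tstar.
(* First pass: for [y] in [J] the ideal [residual K y] is tightly closed and contains [I], hence
   contains [tstar p I]. *)
have {}IJK y x : ideal_set J y -> ideal_set (tstar p I) x -> ideal_set K (y * x).
  move=> Jy; suff: tstar p I `<=` residual K y by apply.
  apply: tstar_min; last exact: tightly_closed_residual.
  by move=> z Iz /=; rewrite mulrC; move/ideal_mulP: IJK; apply.
(* Second pass: with [x] now in [tstar p I], the first pass puts [J] inside [residual K x]. *)
apply/ideal_mulP => x y Ix; suff: tstar p J `<=` residual K x by apply.
apply: tstar_min; last exact: tightly_closed_residual.
by move=> z Jz /=; rewrite mulrC; exact: IJK.
Qed.

Lemma tstar_semiprime : semiprime_operation (@tstar R p).
Proof.
split=> [I|I J IJ|I|I J].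
- exact: sub_tstar.
- apply: tstar_min; last exact: tightly_closed_tstar.
  exact: subset_trans IJ (@sub_tstar J).
- exact/tstar_fixed/tightly_closed_tstar.
- exact: tstar_mul.
Qed.

(** By idempotence [op I] is tightly closed, so minimality puts [tstar p I] inside it; conversely
    [op] fixes [tstar p I], and monotonicity applied to [I] inside [tstar p I] gives the other
    inclusion. *)
Lemma tstar_unique (op : ideal R -> ideal R) :
  semiprime_operation op -> (forall I, op I = I <-> tightly_closed p I) ->
  tstar p = op.
Proof.
move=> [op_ext op_mono op_idem _] op_fix; apply/funext => I; apply: ideal_ext.
  by apply: tstar_min => //; exact/op_fix.
have /op_fix <- := tightly_closed_tstar I.
exact/op_mono/sub_tstar.
Qed.

Hypothesis charRp : p \in [pchar R].

Lemma exprD_pchar_pow e x y : (x + y) ^+ (p ^ e) = x ^+ (p ^ e) + y ^+ (p ^ e).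
Proof.
apply: exprDn_pchar; rewrite pnatX; apply/orP; left.
by rewrite pnatE // (pcharf_prime charRp).
Qed.

(** This is the preimage of [K : c] under the iterated Frobenius, which is a ring endomorphism in
    characteristic [p]. *)
Lemma frob_residual_is_ideal K c e :
  is_ideal [set x | ideal_set K (c * x ^+ (p ^ e))].
Proof.
split=> [|x y Kx Ky|a x Kx] /=.
(* Since [0 ^+ 0 = 1], the exponent [p ^ e] must be seen to be positive. *)
- by rewrite expr0n expn_eq0 -leqn0 leqNgt prime_gt0 ?(pcharf_prime charRp) //
    mulr0; exact: ideal0.
- by rewrite exprD_pchar_pow mulrDr; exact: idealD.
- by rewrite exprMn mulrCA; exact: idealMl.
Qed.

Lemma tclosure_is_ideal I : is_ideal (tclosure p I).
Proof.
split=> [|x y [c oc [m xc]] [d od [n yd]]|a x [c oc [m xc]]].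
- exact/sub_tclosure/ideal0.
- exists (c * d); first exact: ring_oM.
  exists (maxn m n) => e; rewrite geq_max => /andP[/xc + /yd].
  rewrite exprD_pchar_pow mulrDr => xI yI.
  apply: idealD; first by rewrite mulrAC mulrC; exact: idealMl.
  by rewrite -mulrA; exact: idealMl.
- exists c => //; exists m => e /xc; rewrite exprMn mulrCA; exact: idealMl.
Qed.

(** Induction on [s]: multiply the multipliers and take the larger threshold. It is meant for a
    finite generating set of [tclosure p I]. *)
Lemma tclosure_common_multiplier I (s : seq R) :
  [set` s] `<=` tclosure p I ->
  exists2 c, ring_o c & exists e0, forall e, (e0 <= e)%N ->
    forall x, x \in s -> ideal_set (frob_power I (p ^ e)) (c * x ^+ (p ^ e)).
Proof.
elim: s => [_|x s IHs sI]; first by exists 1; [exact: ring_o1 | exists 0%N].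
have [|c oc [m sc]] := IHs.
  by move=> y ys; apply: sI; rewrite /= inE; apply/orP; right.
have [|d od [n xd]] := sI x; first exact: mem_head.
exists (c * d); first exact: ring_oM.
exists (maxn m n) => e; rewrite geq_max => /andP[/sc sce /xd xde] y.
rewrite inE => /predU1P[->|/sce]; first by rewrite -mulrA; exact: idealMl.
by rewrite [c * d]mulrC -mulrA; exact: idealMl.
Qed.

Lemma noetherian_tclosure I : noetherian R -> tclosure p I = tstar p I.
Proof.
move=> noeR; apply/seteqP; split; first exact: tclosure_sub_tstar.
pose T := Ideal (tclosure_is_ideal I).
apply: (@tstar_min I T); first exact: sub_tclosure.
have [s Ts] := noeR T.
have [|c oc [m sc]] := @tclosure_common_multiplier I s.
  rewrite -[tclosure p I]/(ideal_set T) Ts; exact: ideal_span_sub.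
(* For large [q], [d * x ^+ q] lies in the Frobenius power of [T], and [c] carries that power into
   the one of [I]. *)
apply/tightly_closedP => x [d od [n xd]]; exists (c * d); first exact: ring_oM.
exists (maxn m n) => e; rewrite geq_max => /andP[/sc sce /xd].
set q := (p ^ e)%N; rewrite -mulrA.
suff: frob_power T q `<=` residual (frob_power I q) c by apply.
apply: frob_power_min => y.
(* For fixed [e], the elements [y] with [c * y ^+ q] in [frob_power I q] form an ideal, so it
   suffices that it contains the generators [s] of [T]. *)
suff: T `<=` Ideal (frob_residual_is_ideal (frob_power I q) c e) by apply.
by rewrite Ts; apply: ideal_span_min => z; exact: sce.
Qed.

End TightClosure.

Theorem proposition14p3 (R : comNzRingType) (p : nat) (hp : p \in [pchar R]) :
  [/\ unique
        (fun op : ideal R -> ideal R =>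
           semiprime_operation op /\
           (forall I : ideal R, op I = I <-> tightly_closed p I))
        (tstar p),
      forall I : ideal R,
        tclosure p I `<=` tclosure p (tstar p I) /\
        tclosure p (tstar p I) = tstar p I,
      noetherian R ->
        forall I : ideal R,
          tclosure p I = tclosure p (tstar p I) /\
          tclosure p (tstar p I) = tstar p I,
      forall I : ideal R,
        [/\ I `<=` tstar p I,
            tightly_closed p (tstar p I) &
            forall J : ideal R,
              I `<=` J -> tightly_closed p J -> tstar p I `<=` J] &
      noetherian R ->
        (fun I : ideal R => tstar p I : set R) = tclosure p].
Proof.
split.
- split=> [|op [op_semi op_fix]]; last exact: tstar_unique.
  by split; [exact: tstar_semiprime | exact: tstar_fixed].
- move=> I; split; last exact: tightly_closed_tstar.
  exact/tclosure_mono/sub_tstar.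
- move=> noeR I; split; last exact: tightly_closed_tstar.
  by rewrite tightly_closed_tstar noetherian_tclosure.
- move=> I; split; [exact: sub_tstar | exact: tightly_closed_tstar |].
  by move=> J; exact: tstar_min.
- by move=> noeR; apply/funext => I; rewrite noetherian_tclosure.
Qed.
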